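(* Let $\{\mathbb{X}_n\}_{n\in\mathbb{N}}$ be a sequence of non-trivial normed linear spaces over $\mathbb{K}$. Let $p\in(1,\infty)$ and let $q$ be its conjugate exponent, $\frac1p+\frac1q=1$. For every non-zero $x=\{x_n\}_{n\in\mathbb{N}}\in\bigoplus_p\mathbb{X}_n$, $$D(x)=\left(\sum_{n=1}^\infty\frac{\|x_n\|^p}{\|x\|_p^p}\,(D(x_n))^q\right)^{\frac1q},$$ where terms with $x_n=0$ are interpreted as $0$.
   Context: $\mathbb{K}=\mathbb{R}$ or $\mathbb{C}$; $\mathbb{X}^*$ is the continuous dual of a normed space $\mathbb{X}$; non-trivial means of dimension more than $0$. For $1\le p<\infty$, $\bigoplus_p\mathbb{X}_n$ is the space of sequences $\{x_n\}$ with $x_n\in\mathbb{X}_n$ and $\sum_n\|x_n\|^p<\infty$, with norm $\|\{x_n\}\|_p=(\sum_n\|x_n\|^p)^{1/p}$. For a non-zero $x$ in a normed space $\mathbb{X}$, $J(x)=\{f\in\mathbb{X}^*:\|f\|=1,\ f(x)=\|x\|\}$ and $D(x)=\operatorname{diam}(J(x))$ (diameter in the norm of $\mathbb{X}^*$). *)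

(* Defs.v *)
From HB Require Import structures.
From mathcomp Require Import all_boot all_order all_algebra.
From mathcomp Require Import complex.
From mathcomp Require Import all_classical all_reals all_analysis.

Set Implicit Arguments.
Unset Strict Implicit.
Unset Printing Implicit Defensive.
Import Order.TTheory GRing.Theory Num.Theory.
Import numFieldNormedType.Exports.

Local Open Scope classical_set_scope.
Local Open Scope ring_scope.

Inductive scalars := RealScalars | ComplexScalars.

Definition scalar_field (R : realType) (k : scalars) : numFieldType :=
  match k with
  | RealScalars => R
  | ComplexScalars => R[i]
  end.

Definition to_real (R : realType) (k : scalars) : scalar_field R k -> R :=
  match k with
  | RealScalars => fun a : R => a
  | ComplexScalars => fun a : R[i] => complex.Re a
  end.

Definition of_real (R : realType) (k : scalars) : R -> scalar_field R k :=
  match k with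
  | RealScalars => fun a : R => a
  | ComplexScalars => fun a : R => (a +i* 0)%C
  end.

(* The norm of a [normedModType K] takes its values in [K], hence in [R[i]]
   (with zero imaginary part) over the complex field; [rnorm] is that norm,
   read as an element of [R]. *)
Definition rnorm (R : realType) (k : scalars)
    (V : normedModType (scalar_field R k)) (v : V) : R := to_real `|v|.

Section ScalarTheory.
Context (R : realType) (k : scalars).
Local Notation K := (scalar_field R k).

Lemma to_realK (a : K) : 0 <= a -> of_real k (to_real a) = a.
Proof.
case: k a => //= -[a b]; rewrite lecE /= => /andP[/eqP -> _] //.
Qed.

Lemma of_realK : cancel (@of_real R k) (@to_real R k).
Proof. by case: k. Qed.

Lemma of_realD : {morph @of_real R k : a b / a + b}.
Proof. by case: k => // a b; rewrite /= /+%R /= addr0. Qed.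

Lemma of_realM : {morph @of_real R k : a b / a * b}.
Proof.
by case: k => // a b; rewrite /= [RHS]/*%R /= mulr0 mul0r subr0 mulr0 addr0.
Qed.

Lemma of_real0 : of_real k (0 : R) = 0.
Proof. by case: k. Qed.

Lemma ler_of_real : {mono @of_real R k : a b / a <= b}.
Proof. by case: k => //= a b; rewrite lecE /= eqxx. Qed.

Lemma rnormE (V : normedModType K) (v : V) : of_real k (rnorm v) = `|v|.
Proof. exact: to_realK. Qed.

Lemma rnorm_ge0 (V : normedModType K) (v : V) : 0 <= rnorm v.
Proof. by rewrite -ler_of_real rnormE of_real0. Qed.

Lemma rnorm0 (V : normedModType K) : rnorm (0 : V) = 0.
Proof. by rewrite /rnorm normr0 -of_real0 of_realK. Qed.

Lemma rnorm0_eq0 (V : normedModType K) (v : V) : rnorm v = 0 -> v = 0.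
Proof. by move=> v0; apply/normr0_eq0; rewrite -rnormE v0 of_real0. Qed.

Lemma rnormN (V : normedModType K) (v : V) : rnorm (- v) = rnorm v.
Proof. by rewrite /rnorm normrN. Qed.

Lemma ler_rnormD (V : normedModType K) (v w : V) :
  rnorm (v + w) <= rnorm v + rnorm w.
Proof. by rewrite -ler_of_real of_realD !rnormE ler_normD. Qed.

Lemma rnormZ (V : normedModType K) (a : K) (v : V) :
  rnorm (a *: v) = to_real `|a| * rnorm v.
Proof.
by apply: (can_inj of_realK); rewrite of_realM to_realK// !rnormE normrZ.
Qed.

End ScalarTheory.

Section Dual.
Context (R : realType) (k : scalars) (V : normedModType (scalar_field R k)).
Local Notation K := (scalar_field R k).

(* Valued in [\bar R]: a linear functional has a finite [dual_norm] exactly when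
   it is continuous. *)
Definition dual_norm (f : V -> K) : \bar R :=
  ereal_sup [set (to_real `|f v|)%:E | v in [set v : V | rnorm v <= 1]].

Definition J (x : V) : set {linear V -> K^o} :=
  [set f : {linear V -> K^o} | [/\ continuous f, dual_norm f = 1%E & f x = `|x|]].

Definition D (x : V) : \bar R :=
  ereal_sup [set dual_norm (f \- g) | f in J x & g in J x].

End Dual.

Section LpSum.
Context (R : realType) (k : scalars).
Local Notation K := (scalar_field R k).
Context (X : nat -> normedModType K) (p : R).

Definition psum (x : forall n, X n) : \bar R :=
  (\sum_(n <oo) (rnorm (x n) `^ p)%:E)%E.

(* The hypothesis [1 <= p] is a parameter of the type because the normed space
   structure on it depends on that hypothesis. *)
Record lpsum (p1 : 1 <= p) := LpSum {
  lpsum_seq :> forall n, X n;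
  lpsumP : `[< (psum lpsum_seq < +oo)%E >] }.

Definition psum_norm (x : forall n, X n) : R := fine (psum x) `^ p^-1.

Hypothesis p1 : 1 <= p.
Local Notation S := (lpsum p1).

HB.instance Definition _ := [isSub for @lpsum_seq p1].
HB.instance Definition _ := gen_eqMixin S.
HB.instance Definition _ := gen_choiceMixin S.

Let p0 : 0 < p. Proof. exact: lt_le_trans p1. Qed.

Lemma psum_ge0 (x : forall n, X n) : (0 <= psum x)%E.
Proof. by apply: nneseries_ge0 => n _ _; rewrite lee_fin powR_ge0. Qed.

Lemma psum_fin (x : S) : psum x \is a fin_num.
Proof. by rewrite ge0_fin_numE ?psum_ge0//; apply/asboolP/lpsumP. Qed.

Lemma psumE (x : forall n, X n) :
  (psum x `^ p^-1 = Lnorm counting p%:E (fun n => (rnorm (x n))%:E))%E.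
Proof.
rewrite Lnorm_counting//; congr poweR; apply: eq_eseriesr => n _.
by rewrite abse_EFin poweR_EFin ger0_norm// rnorm_ge0.
Qed.

Lemma psum_minkowski (x y : forall n, X n) :
  (psum (fun n => (x n + y n)%R) `^ p^-1 <= psum x `^ p^-1 + psum y `^ p^-1)%E.
Proof.
apply: (@le_trans _ _ (Lnorm counting p%:E
   (EFin \o ((fun n => rnorm (x n)) \+ (fun n => rnorm (y n)))%R))).
  rewrite Lnorm_counting// gt0_ler_poweR ?invr_ge0 ?(ltW p0)//.
  - by rewrite in_itv /= psum_ge0 leey.
  - rewrite in_itv /= leey andbT; apply: nneseries_ge0 => n _ _.
    by rewrite lee_fin powR_ge0.
  - apply: lee_nneseries => [n _|n _]; first by rewrite lee_fin powR_ge0.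
    rewrite /= lee_fin ge0_ler_powR ?(ltW p0)//.
    + exact: rnorm_ge0.
    + by rewrite (le_trans (ler_rnormD _ _))// ler_norm.
apply: (le_trans (minkowski_EFin _ _ _ p1)) => //.
by rewrite !psumE.
Qed.

Lemma lpsum0P : `[< (psum (fun n => (0 : X n)%R) < +oo)%E >].
Proof.
apply/asboolP; rewrite /psum eseries0// => n _ _.
by rewrite rnorm0 powR0// gt_eqF.
Qed.

Lemma lpsumNP (x : S) : `[< (psum (fun n => (- x n)%R) < +oo)%E >].
Proof.
have /asboolP xoo := lpsumP x; apply/asboolP.
by rewrite /psum; under eq_eseriesr do rewrite rnormN.
Qed.

Lemma lpsumDP (x y : S) : `[< (psum (fun n => (x n + y n)%R) < +oo)%E >].
Proof.
apply/asboolP; apply: (@lty_poweRy _ _ p^-1); first by rewrite invr_eq0 gt_eqF.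
apply: (le_lt_trans (psum_minkowski _ _)).
by apply: lte_add_pinfty; apply: poweR_lty; apply/asboolP/lpsumP.
Qed.

Lemma psumZ (a : K) (x : forall n, X n) :
  psum (fun n => a *: x n) = ((to_real `|a| `^ p)%:E * psum x)%E.
Proof.
rewrite /psum -nneseriesZl//; last by move=> n _; rewrite lee_fin powR_ge0.
apply: eq_eseriesr => n _; rewrite rnormZ powRM ?rnorm_ge0//.
Qed.

Lemma lpsumZP (a : K) (x : S) : `[< (psum (fun n => (a *: x n)%R) < +oo)%E >].
Proof.
apply/asboolP; rewrite psumZ; have := psum_fin x.
by case: (psum x) => // r _; rewrite -EFinM ltry.
Qed.

Let zero : S := LpSum p1 lpsum0P.
Let opp (x : S) : S := LpSum p1 (lpsumNP x).
Let add (x y : S) : S := LpSum p1 (lpsumDP x y).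
Let scale (a : K) (x : S) : S := LpSum p1 (lpsumZP a x).

Lemma lpsum_ext (x y : S) : (forall n, x n = y n) -> x = y.
Proof. by move=> xy; apply: val_inj; apply: functional_extensionality_dep. Qed.

Let addA : associative add.
Proof. by move=> x y z; apply: lpsum_ext => n /=; rewrite addrA. Qed.
Let addC : commutative add.
Proof. by move=> x y; apply: lpsum_ext => n /=; rewrite addrC. Qed.
Let add0 : left_id zero add.
Proof. by move=> x; apply: lpsum_ext => n /=; rewrite add0r. Qed.
Let addN : left_inverse zero opp add.
Proof. by move=> x; apply: lpsum_ext => n /=; rewrite addNr. Qed.

HB.instance Definition _ := GRing.isZmodule.Build S addA addC add0 addN.

Let scaleA a b (x : S) : scale a (scale b x) = scale (a * b) x.
Proof. by apply: lpsum_ext => n /=; rewrite scalerA. Qed.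
Let scale1 : left_id 1 scale.
Proof. by move=> x; apply: lpsum_ext => n /=; rewrite scale1r. Qed.
Let scaleDr : right_distributive scale +%R.
Proof. by move=> a x y; apply: lpsum_ext => n /=; rewrite scalerDr. Qed.
Let scaleDl (x : S) : {morph scale^~ x : a b / a + b}.
Proof. by move=> a b; apply: lpsum_ext => n /=; rewrite scalerDl. Qed.

HB.instance Definition _ :=
  GRing.Zmodule_isLmodule.Build K S scaleA scale1 scaleDr scaleDl.

Lemma EFin_psum_norm (x : S) : (psum_norm x)%:E = (psum x `^ p^-1)%E.
Proof. by rewrite /psum_norm -poweR_EFin fineK// psum_fin. Qed.

Let norm (x : S) : K := of_real k (psum_norm x).

Let normD (x y : S) : norm (x + y) <= norm x + norm y.
Proof.
have aux (a b c : R) (A B C : \bar R) : a%:E = A -> b%:E = B -> c%:E = C ->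
    (A <= B + C)%E -> a <= b + c.
  by move=> <- <- <-; rewrite -EFinD lee_fin.
have /= le_xy := aux _ _ _ _ _ _ (EFin_psum_norm (x + y)) (EFin_psum_norm x)
  (EFin_psum_norm y) (psum_minkowski x y).
by rewrite -(@ler_of_real R k) of_realD in le_xy.
Qed.

Let normZ (a : K) (x : S) : norm (a *: x) = `|a| * norm x.
Proof.
rewrite /norm -[`|a|]to_realK// -of_realM; congr of_real.
have a0 : 0 <= to_real `|a| by rewrite -(@ler_of_real R k) to_realK// of_real0.
rewrite /psum_norm psumZ fineM ?psum_fin//= powRM ?powR_ge0 ?fine_ge0 ?psum_ge0//.
by rewrite -powRrM divff ?gt_eqF// powRr1.
Qed.

Let norm0_eq0 (x : S) : norm x = 0 -> x = 0.
Proof.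
rewrite /norm -of_real0 => /(can_inj (@of_realK R k))/eqP.
rewrite powR_eq0 => /andP[/eqP px0 _].
have {}px0 : psum x = 0%E by rewrite -[psum x]fineK ?psum_fin// px0.
apply: lpsum_ext => n; apply: rnorm0_eq0.
have xn_ge0 m : (0 <= (rnorm (x m) `^ p)%:E)%E by rewrite lee_fin powR_ge0.
have := @nneseriesD1 R (fun m => (rnorm (x m) `^ p)%:E) n xpredT.
move=> /(_ (fun m _ => xn_ge0 m) erefl)/esym/eqP.
rewrite -/(psum x) px0 padde_eq0//; last exact: nneseries_ge0.
by move=> /andP[/eqP[/powR_eq0_eq0]].
Qed.

HB.instance Definition _ :=
  Lmodule_isNormed.Build K S normD normZ norm0_eq0.

Lemma lpsum_addE (x y : S) n : (x + y) n = x n + y n.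
Proof. by []. Qed.

Lemma lpsum_scaleE (a : K) (x : S) n : (a *: x) n = a *: x n.
Proof. by []. Qed.

Lemma rnorm_lpsumE (x : S) : rnorm x = psum_norm x.
Proof. exact: of_realK. Qed.

End LpSum.

(* Main.v *)
(* Write N = ||x||, let f_n be the restriction of f in X^* to the n-th summand,
   and c_n = (||x_n|| / N)^(p-1), so that c_n^q = ||x_n||^p / N^p sums to 1.
   Comparing f with the norm along x + t u, u in the n-th summand, as t -> 0
   shows that f is in J(x) only if |f_n| <= c_n and f_n(x_n) = c_n ||x_n||; hence
   f_n = c_n phi_n with phi_n in J(x_n) (and f_n = 0 when x_n = 0).  Hoelder's
   inequality then bounds ||f - g|| by the l^q norm of (c_n D(x_n)).  Conversely,
   starting from a support functional given by Hahn-Banach, finitely many f_n may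
   be replaced by arbitrary c_n phi_n without leaving J(x), so no infinite sum of
   functionals is needed: testing f - g on a finitely supported vector that is
   extremal in Hoelder's inequality gives every partial sum as a lower bound. *)

Require Import Defs.
From HB Require Import structures.
From mathcomp Require Import all_boot all_order all_algebra.
From mathcomp Require Import ring lra complex.
From mathcomp Require Import all_classical all_reals all_analysis.

Import Order.TTheory GRing.Theory Num.Theory.
Import numFieldNormedType.Exports.

Local Open Scope classical_set_scope.
Local Open Scope ring_scope.

Lemma ex_linear (K : pzRingType) (U V : lmodType K) (f : U -> V) :
  linear f -> exists F : {linear U -> V}, F =1 f.
Proof.
move=> fl.
by pose F : {linear U -> V} :=
  HB.pack f (@GRing.isLinear.Build _ _ _ _ f fl); exists F.
Qed.

(** * The Hahn-Banach theorem *)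

Section HahnBanach.
Context (R : realType) (V : lmodType R) (p : V -> R) (x0 : V).
Hypothesis pD : forall v w, p (v + w) <= p v + p w.
Hypothesis pZ : forall t v, 0 <= t -> p (t *: v) = t * p v.

(* Partial linear functionals below [p] are handled through their graphs; the
   empty graph is allowed because [Zorn_bigcup] starts from the empty chain. *)
Let dominated (G : set (V * R)) :=
  [/\ forall t z z', G z -> G z' -> G (t *: z.1 + z'.1, t * z.2 + z'.2),
      forall z, G z -> z.2 <= p z.1 &
      G !=set0 -> G (x0, p x0)].

Let p0 : p 0 = 0.
Proof. by rewrite -[0 in LHS](scale0r x0) pZ// mul0r. Qed.

(** For negative [t] the bound comes from [0 = p (x0 - x0) <= p x0 + p (- x0)]. This graph rules out
    an empty maximal one. *)
Lemma dominated_line : dominated (range (fun t : R => (t *: x0, t * p x0))).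
Proof.
split=> [t _ _ [a _ <-] [b _ <-]|_ [t _ <-]|_] /=.
- by exists (t * a + b) => //; rewrite scalerDl scalerA mulrDl mulrA.
- have [t0|t0] := leP 0 t; first by rewrite pZ.
  have -> : t *: x0 = (- t) *: (- x0) by rewrite scalerN scaleNr opprK.
  have := pD x0 (- x0); rewrite subrr p0 pZ; last by rewrite oppr_ge0 ltW.
  nra.
- by exists 1 => //; rewrite scale1r mul1r.
Qed.

Lemma dominated_bigcup (F : set (set (V * R))) :
  F `<=` dominated -> total_on F subset -> dominated (\bigcup_(G in F) G).
Proof.
move=> Fd Ft; split=> [t z z' [G FG Gz] [G' FG' Gz']|z [G FG Gz]|[z [G FG Gz]]].
- have [GG'|G'G] := Ft _ _ FG FG'.
  + by exists G' => //; have [+ _ _] := Fd _ FG'; apply=> //; exact: GG'.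
  + by exists G => //; have [+ _ _] := Fd _ FG; apply=> //; exact: G'G.
- by have [_ + _] := Fd _ FG; apply.
- by exists G => //; have [_ _] := Fd _ FG; apply; exists z.
Qed.

(** [c] must lie above all [z.2 - p (z.1 - v)] and below all [p (z.1 + v) - z.2]; subadditivity
    keeps these families apart. If [v] is already in the domain, the two bounds force its old
    value. *)
Lemma dominated_extend (G : set (V * R)) (v : V) : dominated G -> G (x0, p x0) ->
  exists2 H, dominated H & G `<=` H /\ exists c, H (v, c).
Proof.
move=> [Gl Gp _] Gx0.
have G0 : G (0, 0).
  have := Gl (-1) _ _ Gx0 Gx0.
  by rewrite /= scaleN1r mulN1r !addNr.
have gap z z' : G z -> G z' -> z.2 - p (z.1 - v) <= p (z'.1 + v) - z'.2.
  move=> Gz Gz'; have := Gp _ (Gl 1 _ _ Gz Gz'); rewrite /= scale1r mul1r.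
  have := pD (z.1 - v) (z'.1 + v); rewrite addrACA addNr addr0; lra.
pose E := [set z.2 - p (z.1 - v) | z in G].
have E0 : has_sup E.
  split; first by exists (0 - p (0 - v)), (0, 0).
  by exists (p (0 + v) - 0) => _ [z Gz <-]; exact: (gap _ (0, 0)).
pose c := sup E.
have lo z : G z -> z.2 - p (z.1 - v) <= c.
  by move=> Gz; apply: sup_upper_bound => //; exists z.
have hi z : G z -> c <= p (z.1 + v) - z.2.
  by move=> Gz; apply: sup_le_ub => [|_ [z' Gz' <-]]; [exact: E0.1|exact: gap].
exists [set y | exists z s, G z /\ y = (z.1 + s *: v, z.2 + s * c)].
  split=> [t _ _ [z [s [Gz ->]]] [z' [s' [Gz' ->]]]|_ [z [s [Gz ->]]]|_] /=.
  - exists (t *: z.1 + z'.1, t * z.2 + z'.2), (t * s + s'); split; first exact: Gl.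
    by rewrite /= scalerDr scalerDl scalerA addrACA; congr pair; ring.
  - have scaled t : G (t *: z.1, t * z.2).
      by have := Gl t _ _ Gz G0; rewrite /= !addr0.
    (* Dividing by [|s|] reduces to [s = 1] and [s = -1], covered by [hi] and [lo]. *)
    have [s0|s0|<-] := ltgtP 0 s.
    + have := hi _ (scaled s^-1) => /=.
      have -> : z.1 + s *: v = s *: (s^-1 *: z.1 + v).
        by rewrite scalerDr scalerA divff ?gt_eqF// scale1r.
      rewrite (pZ s _ (ltW s0)) => /(ler_wpM2l (ltW s0)).
      by rewrite mulrBr mulrA divff ?gt_eqF// mul1r; lra.
    + have := lo _ (scaled (- s)^-1) => /=.
      have s0' : 0 < - s by rewrite oppr_gt0.
      have -> : z.1 + s *: v = (- s) *: ((- s)^-1 *: z.1 - v).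
        by rewrite scalerBr scalerA divff ?gt_eqF// scale1r scaleNr opprK.
      rewrite (pZ (- s) _ (ltW s0')) => /(ler_wpM2l (ltW s0')).
      by rewrite mulrBr mulrA divff ?gt_eqF// mul1r; lra.
    + by rewrite scale0r mul0r !addr0; exact: Gp.
  - by exists (x0, p x0), 0; rewrite scale0r mul0r !addr0.
split=> [z Gz|].
  by exists z, 0; rewrite scale0r mul0r !addr0 -surjective_pairing.
by exists c, (0, 0), 1; rewrite /= !add0r scale1r mul1r.
Qed.

Theorem hahn_banach : exists f : {linear V -> R^o},
  (forall v, f v <= p v) /\ f x0 = p x0.
Proof.
have [G [Gd Gmax]] := Zorn_bigcup dominated_bigcup.
have Gx0 : G (x0, p x0).
  have [_ _] := Gd; apply; apply/set0P/negP => /eqP G0.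
  apply: (Gmax _ _ dominated_line); rewrite G0; split=> //.
  by move=> /(_ (0 *: x0, 0 * p x0)); apply; exists 0.
have Gdom v : exists c, G (v, c).
  have [H Hd [GH Hv]] := dominated_extend _ v Gd Gx0.
  have [HG|nHG] := pselect (H `<=` G).
    by have [c Hc] := Hv; exists c; exact: HG.
  by have := Gmax H (conj GH nHG).
have [Gl Gp _] := Gd.
pose f v := projT1 (cid (Gdom v)).
have fP v : G (v, f v) by rewrite /f; case: cid.
(* Domination makes the graph single-valued: [(0, a - b)] lies in [G], so [a - b <= p 0 = 0]. *)
have le_f v a b : G (v, a) -> G (v, b) -> a <= b.
  move=> Ga Gb; have := Gp _ (Gl (-1) _ _ Gb Ga).
  by rewrite /= scaleN1r addNr p0; lra.
have fE v a : G (v, a) -> f v = a.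
  by move=> Ga; apply/le_anti; rewrite !(le_f v).
have [|F Ff] := ex_linear _ V R^o f.
  by move=> a v w; apply: fE; exact: (Gl a (v, f v) (w, f w)).
exists F; split=> [v|]; last by rewrite Ff; exact: fE.
by rewrite Ff; exact: (Gp (v, f v)).
Qed.

End HahnBanach.

(** * Support functionals over both scalar fields *)

Section Scalars.
Context (R : realType) (k : scalars).
Local Notation K := (scalar_field R k).

Lemma of_real1 : of_real k (1 : R) = 1.
Proof. by case: k. Qed.

Lemma to_realD (a b : K) : to_real (a + b) = to_real a + to_real b.
Proof. by case: k a b => //= -[a a'] [b b']. Qed.

Lemma to_real0 : to_real (0 : K) = 0.
Proof. by rewrite -(@of_real0 R k) of_realK. Qed.

Lemma to_real_sum (M : nat) (u : 'I_M -> K) :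
  to_real (\sum_(n < M) u n) = \sum_(n < M) to_real (u n).
Proof. exact: (big_morph _ to_realD to_real0). Qed.

Lemma to_realZ (t : R) (a : K) : to_real (of_real k t * a) = t * to_real a.
Proof. by case: k a => //= -[a a']; rewrite /= mul0r subr0. Qed.

Lemma to_real_le_norm (a : K) : to_real a <= to_real `|a|.
Proof.
case: k a => [a|[a b]]; first exact: ler_norm.
rewrite /= (le_trans (ler_norm _))// -sqrtr_sqr ler_wsqrtr// lerDl.
exact: sqr_ge0.
Qed.

(** Since [|a| <= r <= Re a <= |a|], the imaginary part vanishes. This turns estimates on real parts
    into equalities in [K]. *)
Lemma to_real_norm_eq (a : K) (r : R) :
  r <= to_real a -> to_real `|a| <= r -> a = of_real k r.
Proof.
case: k a => [a /= ra ar|[a b] /= ra abr].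
  by apply/le_anti; rewrite ra (le_trans (ler_norm a) ar).
have a_le : a <= Num.sqrt (a ^+ 2 + b ^+ 2).
  by rewrite (le_trans (ler_norm _))// -sqrtr_sqr ler_wsqrtr// lerDl sqr_ge0.
have ar : a = r by apply/le_anti; rewrite ra (le_trans a_le).
have r0 : 0 <= r by exact: le_trans abr.
have : a ^+ 2 + b ^+ 2 <= r ^+ 2.
  by rewrite -(@sqr_sqrtr _ (a ^+ 2 + b ^+ 2)) ?addr_ge0 ?sqr_ge0// lerXn2r ?nnegrE.
rewrite ar gerDl => b0; congr Complex.
by apply/eqP; rewrite -sqrf_eq0; apply/eqP/le_anti; rewrite b0 sqr_ge0.
Qed.

Lemma to_real_norm_of_real (t : R) : 0 <= t -> to_real `|of_real k t : K| = t.
Proof.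
move=> t0; rewrite ger0_norm ?of_realK//.
by rewrite -(@of_real0 R k) ler_of_real.
Qed.

(** Multiplying a vector by [u] turns the modulus of a functional into a real part and keeps the
    norm of the vector. *)
Lemma ex_rotation (a : K) : exists2 u : K, `|u| = 1 & u * a = `|a|.
Proof.
have [->|a0] := eqVneq a 0; first by exists 1; rewrite ?normr1// mulr0 normr0.
by exists (`|a| / a); rewrite ?divfK// normf_div normr_id divff// normr_eq0.
Qed.

Lemma rnormZr (V : normedModType K) (t : R) (v : V) :
  0 <= t -> rnorm (of_real k t *: v) = t * rnorm v.
Proof. by move=> t0; rewrite rnormZ to_real_norm_of_real. Qed.

Lemma rnorm_gt0 (V : normedModType K) (v : V) : (0 < rnorm v) = (v != 0).
Proof.
rewrite lt0r rnorm_ge0 andbT; congr (~~ _).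
by apply/eqP/eqP => [/rnorm0_eq0|->] //; exact: rnorm0.
Qed.

Lemma ler_rnorm_sum (V : normedModType K) (M : nat) (u : nat -> V) :
  rnorm (\sum_(n < M) u n) <= \sum_(n < M) rnorm (u n).
Proof.
elim: M => [|M IH]; first by rewrite !big_ord0 rnorm0.
by rewrite !big_ord_recr /= (le_trans (ler_rnormD _ _))// lerD2r.
Qed.

End Scalars.

(** A copy of [V] under a new name, so that the [R]-module structure by restriction of scalars does
    not compete with the structure of [V]. *)
Definition realification (R : realType) (k : scalars)
  (V : normedModType (scalar_field R k)) : Type := V.

Section Realification.
Context (R : realType) (k : scalars) (V : normedModType (scalar_field R k)).

HB.instance Definition _ := GRing.Zmodule.on (realification R k V).

Let scale (t : R) (v : realification R k V) : realification R k V :=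
  of_real k t *: (v : V).

Let scaleA a b v : scale a (scale b v) = scale (a * b) v.
Proof. by rewrite /scale scalerA of_realM. Qed.
Let scale1 : left_id 1 scale.
Proof. by move=> v; rewrite /scale of_real1 scale1r. Qed.
Let scaleDr : right_distributive scale +%R.
Proof. by move=> a v w; rewrite /scale scalerDr. Qed.
Let scaleDl v : {morph scale^~ v : a b / a + b}.
Proof. by move=> a b; rewrite /scale of_realD scalerDl. Qed.

HB.instance Definition _ := GRing.Zmodule_isLmodule.Build R
  (realification R k V) scaleA scale1 scaleDr scaleDl.

End Realification.

Lemma ex_norming_real (R : realType) (k : scalars)
    (V : normedModType (scalar_field R k)) (x : V) :
  exists u : V -> R, [/\ {morph u : v w / v + w},
    forall t v, u (of_real k t *: v) = t * u v,
    forall v, u v <= rnorm v & u x = rnorm x].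
Proof.
have [v w|t v t0|u [u_le ux]] :=
  hahn_banach R (realification R k V) (@rnorm R k V) x.
- exact: ler_rnormD.
- exact: rnormZr.
by exists u; split=> // [v w|t v]; [exact: (raddfD u)|exact: (linearZ_LR u)].
Qed.

Section Complexification.
Context (R : realType) (V : normedModType R[i]) (u : V -> R).
Hypothesis uD : {morph u : v w / v + w}.
Hypothesis uZ : forall t v, u ((t +i* 0)%C *: v) = t * u v.

(** The classical formula [u v - i u (i v)], by which a real-linear [u] becomes the real part of a
    complex-linear functional. *)
Lemma complexify_linear :
  linear (fun v => (u v +i* (- u ('i%C *: v)))%C : R[i]^o).
Proof.
have uN v : u (- v) = - u v.
  have -> : - v = ((- 1) +i* 0)%C *: v.
    by rewrite -scaleN1r; congr (_ *: _); apply/eqP;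
       rewrite eq_complex /= oppr0 !eqxx.
  by rewrite uZ mulN1r.
move=> [a b] v w.
have -> : (a +i* b)%C = (a +i* 0)%C + (b +i* 0)%C * 'i%C.
  apply/eqP; rewrite eq_complex /=.
  by rewrite !(mulr0, mulr1, mul0r, subr0, addr0, add0r) !eqxx.
set A := (a +i* 0)%C; set B := (b +i* 0)%C.
have uE : u ((A + B * 'i%C) *: v) = a * u v + b * u ('i%C *: v).
  by rewrite scalerDl uD -scalerA !uZ.
have uiE : u ('i%C *: ((A + B * 'i%C) *: v)) = a * u ('i%C *: v) - b * u v.
  rewrite scalerA mulrDr mulrCA -expr2 sqr_i mulrN1 scalerDl uD scaleNr uN.
  by rewrite mulrC -scalerA !uZ.
rewrite scalerDr !uD uE uiE.
by apply/eqP; rewrite eq_complex /=; apply/andP; split; apply/eqP;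
  rewrite /GRing.scale /=; ring.
Qed.

End Complexification.

Lemma ex_norming (R : realType) (k : scalars)
    (V : normedModType (scalar_field R k)) (x : V) :
  exists f : {linear V -> (scalar_field R k)^o},
    (forall v, rnorm (f v : (scalar_field R k)^o) <= rnorm v) /\ f x = `|x|.
Proof.
have [u [uD uZ u_le ux]] := ex_norming_real R k V x.
have [f fu] : exists f : {linear V -> (scalar_field R k)^o},
    forall v, to_real (f v) = u v.
  case: k V x u uD uZ u_le ux => V x u uD uZ _ _.
    have [|F Fu] := ex_linear _ V R^o u; last by exists F.
    by move=> a v w; rewrite uD; congr (_ + _); exact: uZ.
  have [F Fu] := ex_linear _ V R[i]^o _ (complexify_linear R V u uD uZ).
  by exists F => v; rewrite Fu.
have f_le v : rnorm (f v : (scalar_field R k)^o) <= rnorm v.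
  have [a a1 afv] := ex_rotation R k (f v).
  rewrite /rnorm -afv -[a * f v]/(a *: (f v : (scalar_field R k)^o)) -linearZ_LR fu.
  by rewrite (le_trans (u_le _))// rnormZ a1 -(of_real1 R) of_realK mul1r.
exists f; split=> //; rewrite -rnormE; apply: to_real_norm_eq; last exact: f_le.
by rewrite fu ux.
Qed.

(** * Support functionals and diameters in a single normed space *)

Section DualNorm.
Context (R : realType) (k : scalars) (V : normedModType (scalar_field R k)).
Local Notation K := (scalar_field R k).

Lemma dual_norm_le (f : V -> K) (C : R) : 0 <= C ->
  (forall v, to_real `|f v| <= C * rnorm v) -> (dual_norm f <= C%:E)%E.
Proof.
move=> C0 fC; apply: ge_ereal_sup => _ [v /= v1 <-].
by rewrite lee_fin (le_trans (fC v))// ler_piMr.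
Qed.

Lemma le_dual_norm (f : {linear V -> K^o}) (C : R) (v : V) :
  (dual_norm f <= C%:E)%E -> to_real `|f v| <= C * rnorm v.
Proof.
move=> fC; have [->|v0] := eqVneq v 0.
  by rewrite linear0 rnorm0 mulr0 normr0 -(@of_real0 R k) of_realK.
have vgt0 : 0 < rnorm v by rewrite rnorm_gt0.
have v'0 : 0 <= (rnorm v)^-1 by rewrite invr_ge0 ltW.
have : ((to_real `|f (of_real k (rnorm v)^-1 *: v)|)%:E <= C%:E)%E.
  apply: le_trans fC; apply: ereal_sup_ubound.
  exists (of_real k (rnorm v)^-1 *: v) => //=.
  by rewrite rnormZr// mulVf// gt_eqF.
by rewrite lee_fin linearZ_LR /= -/(rnorm (_ : K^o)) rnormZr// ler_pdivrMl// mulrC.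
Qed.

(** A functional below the norm is continuous with dual norm at most 1, and the normalized [x] shows
    that 1 is reached. Membership in [J x] becomes a pointwise condition. *)
Lemma JP (x : V) (f : {linear V -> K^o}) : x != 0 ->
  J x f <-> (forall v, to_real `|f v| <= rnorm v) /\ f x = `|x|.
Proof.
move=> x0; split=> [[_ f1 fx]|[f_le fx]].
  by split=> // v; rewrite -[leRHS]mul1r; apply: le_dual_norm; rewrite f1.
have xgt0 : 0 < rnorm x by rewrite rnorm_gt0.
split=> //.
  apply/linear_bounded_continuous/linear_boundedP.
  exists 1; split=> [|r r1 v]; first exact: real1.
  rewrite -[`|f v|]to_realK// -[`|v|]to_realK//.
  apply: (@le_trans _ _ (of_real k (rnorm v))); first by rewrite ler_of_real.
  apply: ler_peMl; last exact: ltW.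
  by rewrite -(@of_real0 R k) ler_of_real rnorm_ge0.
apply/le_anti/andP; split.
  by apply: dual_norm_le => // v; rewrite mul1r.
apply: ereal_sup_ubound; exists (of_real k (rnorm x)^-1 *: x) => /=.
  by rewrite rnormZr ?mulVf ?gt_eqF// invr_ge0 ltW.
rewrite linearZ_LR /= -/(rnorm (_ : K^o)) rnormZr ?invr_ge0 ?ltW//.
by rewrite fx {2}/rnorm normr_id mulVf// gt_eqF.
Qed.

Lemma J_nonempty (x : V) : x != 0 -> exists f, J x f.
Proof.
by move=> x0; have [f fP] := ex_norming R k V x; exists f; apply/JP.
Qed.

Context (x : V).
Hypothesis x0 : x != 0.

Lemma D_ge0 : (0 <= D x)%E.
Proof.
have [f Jf] := J_nonempty x x0.
apply: (@le_trans _ _ (dual_norm (f \- f))).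
  apply: ereal_sup_ubound; exists 0; first by rewrite /= rnorm0.
  by rewrite /= subrr normr0 -(@of_real0 R k) of_realK.
by apply: ereal_sup_ubound; exists f => //; exists f.
Qed.

(** Triangle inequality; it makes [D x] finite, so that later estimates can be run in [R]. *)
Lemma D_le2 : (D x <= 2%:E)%E.
Proof.
apply: ge_ereal_sup => _ [f /JP[//|f1 _] [g /JP[//|g1 _] <-]].
apply: dual_norm_le => // v /=.
have := ler_rnormD (f v : K^o) (- g v); rewrite rnormN /rnorm => /le_trans; apply.
by have := f1 v; have := g1 v; rewrite /rnorm; lra.
Qed.

Lemma D_fin_num : D x \is a fin_num.
Proof.
by rewrite ge0_fin_numE ?D_ge0// (le_lt_trans D_le2)// ltry.
Qed.

Lemma fine_D_ge0 : 0 <= fine (D x).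
Proof. by rewrite fine_ge0 ?D_ge0. Qed.

Lemma fine_D_le2 : fine (D x) <= 2.
Proof. by rewrite -lee_fin fineK ?D_fin_num ?D_le2. Qed.

Lemma J_dist (f g : {linear V -> K^o}) (v : V) : J x f -> J x g ->
  to_real `|f v - g v| <= fine (D x) * rnorm v.
Proof.
move=> Jf Jg; apply: (le_dual_norm (f \- g : {linear V -> K^o})).
rewrite fineK ?D_fin_num//; apply: ereal_sup_ubound.
by exists f => //; exists g.
Qed.

(** The suprema need not be attained. The loss is a factor rather than an additive error because a
    common factor passes through the l^q norm. *)
Lemma D_almost_attained (lambda : R) : 0 < lambda < 1 ->
  exists f g v, [/\ J x f, J x g, rnorm v <= 1 &
    lambda * fine (D x) <= to_real (f v - g v)].
Proof.
move=> /andP[l0 l1]; have [f0 Jf0] := J_nonempty x x0.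
have [D0|D0] := eqVneq (fine (D x)) 0.
  exists f0, f0, 0; split=> //; first by rewrite rnorm0.
  by rewrite D0 mulr0 subrr -(@of_real0 R k) of_realK.
have : ((lambda * fine (D x))%:E < D x)%E.
  rewrite -[ltRHS]fineK ?D_fin_num// lte_fin gtr_pMl// lt0r D0.
  exact: fine_D_ge0.
move=> /ereal_sup_gt[_ [f Jf [g Jg <-]]] /ereal_sup_gt[_ [v /= v1 <-]].
rewrite lte_fin => /ltW lfg.
have [a a1 afg] := ex_rotation R k (f v - g v).
exists f, g, (a *: v); split=> //.
  by rewrite rnormZ a1 -(of_real1 R) of_realK mul1r.
have -> : f (a *: v) - g (a *: v) = a * (f v - g v) by rewrite mulrBr !linearZ_LR.
by rewrite afg.
Qed.

End DualNorm.

(** * Inequalities for real powers *)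

Section PowerInequalities.
Context (R : realType).
Implicit Types (a b p q r s t w : R).

(** Right continuity of the power; the test value of [e] is half the gap between [w] and
    [r ^ (1 / a)]. *)
Lemma le_powR_right_limit a w r : 0 < a -> 0 <= w ->
  (forall e, 0 < e -> r <= (w + e) `^ a) -> r <= w `^ a.
Proof.
move=> a0 w0 hr; rewrite leNgt; apply/negP => wr.
have r0 : 0 < r by apply: le_lt_trans wr; exact: powR_ge0.
have rE : (r `^ a^-1) `^ a = r by rewrite -powRrM mulVf ?gt_eqF// powRr1// ltW.
have [rw|rw] := leP (r `^ a^-1) w.
  have : r <= w `^ a by rewrite -rE ge0_ler_powR ?nnegrE ?powR_ge0// ltW.
  by rewrite leNgt wr.
have := hr ((r `^ a^-1 - w) / 2); rewrite divr_gt0 ?subr_gt0// => /(_ erefl).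
rewrite leNgt => /negP; apply.
rewrite -[ltRHS]rE; apply: gt0_ltr_powR; rewrite ?nnegrE ?powR_ge0//; lra.
Qed.

Lemma powR_left_limit_le a w s : 0 < a -> 0 <= w ->
  (forall t, 0 < t < 1 -> ((1 - t) * w) `^ a <= s) -> w `^ a <= s.
Proof.
move=> a0 w0 hs; rewrite leNgt; apply/negP => sw.
have s0 : 0 <= s.
  by apply: le_trans (hs 2^-1 _); [exact: powR_ge0|apply/andP; split; lra].
have sE : (s `^ a^-1) `^ a = s by rewrite -powRrM mulVf ?gt_eqF// powRr1.
have {}sw : s `^ a^-1 < w.
  rewrite ltNge; apply/negP => ws.
  have : w `^ a <= s by rewrite -sE ge0_ler_powR ?nnegrE ?powR_ge0// ltW.
  by rewrite leNgt sw.
set s' := s `^ a^-1 in sE sw; have s'0 : 0 <= s' by exact: powR_ge0.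
have wgt0 : 0 < w by exact: le_lt_trans sw.
(* This [t] places [(1 - t) * w] midway between [s'] and [w]. *)
have := hs ((w - s') / (2 * w)).
have -> : (1 - (w - s') / (2 * w)) * w = (w + s') / 2 by field; lra.
rewrite divr_gt0 ?subr_gt0 ?mulr_gt0// ltr_pdivrMr ?mulr_gt0// mul1r.
have -> : w - s' < 2 * w by lra.
move=> /(_ erefl); rewrite leNgt => /negP; apply.
by rewrite -[ltLHS]sE; apply: gt0_ltr_powR; rewrite ?nnegrE//; lra.
Qed.

Lemma powR_le_inv r a w : 0 < r -> 0 <= a -> 0 <= w ->
  a `^ r <= w `^ r -> a <= w.
Proof.
move=> r0 a0 w0; rewrite leNgt => /negP aw; rewrite leNgt; apply/negP => wa.
by apply: aw; apply: gt0_ltr_powR.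
Qed.

Lemma powR_div a w r : 0 <= a -> 0 <= w -> (a / w) `^ r = a `^ r / w `^ r.
Proof.
move=> a0 w0; rewrite powRM ?invr_ge0//; congr (_ * _).
by rewrite -powR_inv1// powRAC powR_inv1// powR_ge0.
Qed.

(** * Inequalities for conjugate exponents *)

Context (p q : R).
Hypotheses (p1 : 1 < p) (pq : p^-1 + q^-1 = 1).

Lemma conjugate_gt0 : 0 < q.
Proof.
have : p^-1 < 1 by rewrite invf_lt1// (lt_trans _ p1).
rewrite -(invr_gt0 q); have := pq; lra.
Qed.

Lemma conjugate_mul : (p - 1) * q = p.
Proof.
have q0 := conjugate_gt0; have p0 := lt_trans ltr01 p1.
have : (p^-1 + q^-1) * (p * q) = q + p by field; rewrite !gt_eqF.
by rewrite pq; lra.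
Qed.

Lemma conjugate_gt1 : 1 < q.
Proof. have := conjugate_mul; have := conjugate_gt0; have := p1; nra. Qed.

Lemma conjugate_mulC : (q - 1) * p = q.
Proof. have := conjugate_mul; lra. Qed.

(** The tangent at [a] to the convex function [t ^ p] lies below it at [b]. This is Young's
    inequality for [a ^ (p - 1)] and [b], as [(p - 1) * q = p]. *)
Lemma powR_tangent a b : 0 <= a -> 0 <= b ->
  p * a `^ (p - 1) * b <= (p - 1) * a `^ p + b `^ p.
Proof.
move=> a0 b0; have p0 := lt_trans ltr01 p1; have q0 := conjugate_gt0.
have := @conjugate_powR R (a `^ (p - 1)) b q p (powR_ge0 _ _) b0 q0 p0.
rewrite addrC => /(_ pq); rewrite -powRrM conjugate_mul => /(ler_wpM2l (ltW p0)).
rewrite mulrA mulrDr => /le_trans; apply; rewrite le_eqVlt; apply/orP; left.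
apply/eqP; congr (_ + _); last by rewrite mulrC divfK// gt_eqF.
have -> : q = p / (p - 1).
  by rewrite -{1}conjugate_mul mulrAC mulfV ?mul1r// gt_eqF// subr_gt0.
by field; rewrite !gt_eqF// subr_gt0.
Qed.

(** Young's inequality is applied to [a n / A] and [b n / B]; a zero bound makes every factor on its
    side zero. Bounds replace the two norms so that one pair can serve all partial sums. *)
Lemma hoelder_sum (M : nat) (a b : nat -> R) (A B : R) :
  (forall n, 0 <= a n) -> (forall n, 0 <= b n) -> 0 <= A -> 0 <= B ->
  \sum_(n < M) a n `^ q <= A `^ q -> \sum_(n < M) b n `^ p <= B `^ p ->
  \sum_(n < M) a n * b n <= A * B.
Proof.
have p0 := lt_trans ltr01 p1; have q0 := conjugate_gt0.
have le0 (u : nat -> R) r : r != 0 -> \sum_(n < M) u n `^ r <= 0 `^ r ->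
    forall n : 'I_M, u n = 0.
  move=> r0; rewrite (powR0 r0) => u0 n.
  have : \sum_(n < M) u n `^ r == 0.
    by rewrite eq_le u0 sumr_ge0// => i _; exact: powR_ge0.
  rewrite psumr_eq0; last by move=> i _; exact: powR_ge0.
  by move=> /allP/(_ n); rewrite mem_index_enum => /(_ erefl)/eqP/powR_eq0_eq0.
move=> a0 b0 A0 B0 aA bB.
have [A0'|An0] := eqVneq A 0.
  rewrite {}A0' in aA *; rewrite mul0r big1// => n _.
  by rewrite (le0 a q) ?mul0r ?gt_eqF.
have [B0'|Bn0] := eqVneq B 0.
  rewrite {}B0' in bB *; rewrite mulr0 big1// => n _.
  by rewrite (le0 b p) ?mulr0 ?gt_eqF.
have {An0}Agt0 : 0 < A by rewrite lt0r An0.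
have {Bn0}Bgt0 : 0 < B by rewrite lt0r Bn0.
have term (n : 'I_M) : a n * b n <=
    A * B * (a n `^ q / A `^ q / q + b n `^ p / B `^ p / p).
  have -> : a n * b n = A * B * ((a n / A) * (b n / B)) by field; rewrite !gt_eqF.
  rewrite ler_wpM2l ?mulr_ge0//.
  rewrite -!powR_div//.
  by apply: conjugate_powR; rewrite ?divr_ge0// addrC.
apply: (le_trans (ler_sum _ (fun n _ => term n))).
rewrite -mulr_sumr -[leRHS]mulr1 ler_wpM2l ?mulr_ge0// big_split /=.
rewrite -!mulr_suml -pq [leRHS]addrC lerD//.
  by rewrite ler_piMl ?invr_ge0 ?(ltW q0)// ler_pdivrMr ?mul1r// powR_gt0.
by rewrite ler_piMl ?invr_ge0 ?(ltW p0)// ler_pdivrMr ?mul1r// powR_gt0.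
Qed.

Lemma conjugate_root_le (B d : R) : 0 <= B -> 0 <= d ->
  B <= d * B `^ p^-1 -> B `^ q^-1 <= d.
Proof.
move=> B0 d0 Bd; have [->|Bn0] := eqVneq B 0.
  by rewrite powR0// invr_eq0 gt_eqF// conjugate_gt0.
have Bp : 0 < B `^ p^-1 by rewrite powR_gt0// lt0r Bn0.
rewrite -(ler_pM2r Bp) -powRD; last by rewrite Bn0 implybT.
by rewrite addrC pq powRr1.
Qed.

(* To be read with N = ||x||, y = ||x + u||, w = ||x_n||, b = ||x_n + u|| and
   r = Re f(u), for u in the n-th summand. *)
Lemma directional_bound (N y b w r : R) :
  0 <= N -> 0 <= y -> 0 <= b -> 0 <= w ->
  N + r <= y -> y `^ p + w `^ p = N `^ p + b `^ p ->
  N `^ (p - 1) * r <= b `^ (p - 1) * (b - w).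
Proof.
move=> N0 y0 b0 w0 Nry ybE; have p0 := lt_trans ltr01 p1.
(* The chain is [p N^(p-1) r <= y^p - N^p = b^p - w^p <= p b^(p-1) (b - w)], with one tangent
   inequality at each end. *)
have Ny := powR_tangent N y N0 y0; have bw := powR_tangent b w b0 w0.
have NE := mulr_powRB1 N0 p0; have bE := mulr_powRB1 b0 p0.
have NNr : p * N `^ (p - 1) * (N + r) <= p * N `^ (p - 1) * y.
  by rewrite ler_wpM2l// mulr_ge0 ?powR_ge0// ltW.
rewrite -(ler_pM2l p0).
move: (N `^ (p - 1)) (b `^ (p - 1)) (N `^ p) (y `^ p) (b `^ p) (w `^ p)
  Ny bw NE bE NNr ybE => N1 b1 Np yp bp wp Ny bw NE bE NNr ybE.
have -> : p * (N1 * r) = p * N1 * (N + r) - p * (N * N1) by ring.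
have -> : p * (b1 * (b - w)) = p * (b * b1) - p * b1 * w by ring.
rewrite NE bE; lra.
Qed.

(** With [s = ||u||] the increment [(e / s) u] has norm [e], so [b - w <= e]; divide by [e] and let
    it tend to 0. *)
Lemma right_directional_bound (m r s w : R) : 0 <= w -> 0 < s ->
  (forall e, 0 < e -> exists2 b, 0 <= b <= w + e &
    m * (e / s * r) <= b `^ (p - 1) * (b - w)) ->
  m * r <= w `^ (p - 1) * s.
Proof.
move=> w0 s0 hb; rewrite -ler_pdivrMr//.
apply: le_powR_right_limit; rewrite ?subr_gt0// => e e0.
have [b /andP[b0 bwe] mb] := hb e e0.
rewrite ler_pdivrMr// -(ler_pM2l e0).
have -> : e * (m * r) = s * (m * (e / s * r)) by field; rewrite gt_eqF.
rewrite [leRHS]mulrA [leRHS]mulrC ler_pM2l//.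
apply: (le_trans mb); rewrite mulrC.
apply: (@le_trans _ _ (e * b `^ (p - 1))).
  by rewrite ler_wpM2r ?powR_ge0//; lra.
rewrite ler_pM2l// ge0_ler_powR ?nnegrE ?subr_ge0 ?(ltW p1)//.
by rewrite addr_ge0// ltW.
Qed.

(** The increment is now [- t] times the coordinate itself, so [b = (1 - t) w] exactly, and the sign
    of [- t] reverses the inequality. *)
Lemma left_directional_bound (m r w : R) : 0 < w ->
  (forall t, 0 < t < 1 ->
    m * (- t * r) <= ((1 - t) * w) `^ (p - 1) * ((1 - t) * w - w)) ->
  w `^ (p - 1) * w <= m * r.
Proof.
move=> w0 hb; rewrite -ler_pdivlMr//.
apply: powR_left_limit_le; rewrite ?subr_gt0 ?(ltW w0)// => t t01.
have hbt := hb t t01; case/andP: t01 => t0 t1.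
rewrite ler_pdivlMr// -(ler_pM2l t0).
move: (_ `^ _) hbt => b; lra.
Qed.

End PowerInequalities.

(** * Coordinates in the l^p sum *)

Section Coordinates.
Context (R : realType) (k : scalars).
Local Notation K := (scalar_field R k).
Context (X : nat -> normedModType K) (p : R) (p1 : 1 <= p).
Local Notation S := (lpsum X p1).

Let p0 : 0 < p. Proof. exact: lt_le_trans p1. Qed.

Let term_ge0 (y : forall n, X n) n : (0 <= (rnorm (y n) `^ p)%:E)%E.
Proof. by rewrite lee_fin powR_ge0. Qed.

(** Kept additive because either series may be infinite, so terms cannot be subtracted freely. *)
Lemma psum_swap (n : nat) (y z : forall m, X m) :
  (forall m, m != n -> y m = z m) ->
  (psum p y + (rnorm (z n) `^ p)%:E = psum p z + (rnorm (y n) `^ p)%:E)%E.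
Proof.
move=> yz; rewrite /psum (@nneseriesD1 _ _ n)//.
rewrite (@nneseriesD1 _ (fun m => (rnorm (z m) `^ p)%:E) n)//.
rewrite addeAC [RHS]addeAC; congr (_ + _)%E; first by rewrite addeC.
by apply: eq_eseriesr => m /= mn; rewrite yz.
Qed.

Let coord_seq n (u : X n) : forall m, X m := @dfwith nat X (fun m => 0) n u.

Lemma psum0 : psum p (fun m => 0 : X m) = 0%E.
Proof.
by rewrite /psum eseries0// => m _ _; rewrite rnorm0 powR0// gt_eqF.
Qed.

Lemma psum_coord_seq n (u : X n) : psum p (coord_seq n u) = (rnorm u `^ p)%:E.
Proof.
have := @psum_swap n (coord_seq n u) (fun m => 0).
rewrite psum0 rnorm0 powR0 ?gt_eqF// adde0 add0e /coord_seq dfwithin; apply=> m mn.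
by rewrite dfwithout// eq_sym.
Qed.

Lemma coord_seqP n (u : X n) : `[< (psum p (coord_seq n u) < +oo)%E >].
Proof. by apply/asboolP; rewrite psum_coord_seq ltry. Qed.

Definition coord_inj n (u : X n) : S := LpSum p1 (coord_seqP n u).

(** Named so that evaluation carries a linear structure and commutes with finite sums. *)
Definition coord_proj n (y : S) : X n := y n.

Lemma lpsum_subE (y z : S) n : (y - z) n = y n - z n.
Proof. by []. Qed.

Lemma coord_injK n (u : X n) : coord_inj n u n = u.
Proof. exact: dfwithin. Qed.

Lemma coord_inj_neq n (u : X n) m : m != n -> coord_inj n u m = 0.
Proof. by move=> mn; rewrite /= /coord_seq dfwithout// eq_sym. Qed.

Lemma coord_inj_linear n : linear (@coord_inj n).
Proof.
move=> a u v; apply: lpsum_ext => m; rewrite lpsum_addE lpsum_scaleE.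
have [->|mn] := eqVneq m n; first by rewrite !coord_injK.
by rewrite !coord_inj_neq// scaler0 addr0.
Qed.

Lemma coord_proj_linear n : linear (@coord_proj n).
Proof. by []. Qed.

HB.instance Definition _ n :=
  GRing.isLinear.Build K (X n) S *:%R (@coord_inj n) (coord_inj_linear n).
HB.instance Definition _ n :=
  GRing.isLinear.Build K S (X n) *:%R (@coord_proj n) (coord_proj_linear n).

Lemma rnorm_powR (y : S) : (rnorm y `^ p)%:E = psum p y.
Proof.
rewrite rnorm_lpsumE /psum_norm -powRrM mulVf ?gt_eqF// powRr1.
  by rewrite fineK// psum_fin.
by rewrite fine_ge0// psum_ge0.
Qed.

Lemma rnorm_swap (n : nat) (y z : S) : (forall m, m != n -> y m = z m) ->
  rnorm y `^ p + rnorm (z n) `^ p = rnorm z `^ p + rnorm (y n) `^ p.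
Proof.
move=> yz; have := psum_swap n y z yz.
by rewrite -(rnorm_powR y) -(rnorm_powR z) => -[].
Qed.

Lemma rnorm_coord_inj n (u : X n) : rnorm (coord_inj n u) = rnorm u.
Proof.
apply: (powR_injective p0); rewrite ?nnegrE ?rnorm_ge0//.
by apply/EFin_inj; rewrite rnorm_powR psum_coord_seq.
Qed.

Lemma sum_coord_injE (M : nat) (u : forall n, X n) (m : nat) :
  (\sum_(n < M) coord_inj n (u n)) m = if (m < M)%N then u m else 0.
Proof.
rewrite -[LHS]/(coord_proj m _) linear_sum /=.
case: ifPn => [mM|Mm].
  rewrite (bigD1 (Ordinal mM))//= [X in X + _]coord_injK big1 ?addr0// => i im.
  by rewrite [LHS]coord_inj_neq// eq_sym.
rewrite big1// => i _; rewrite [LHS]coord_inj_neq//.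
by apply: contraNneq Mm => ->.
Qed.

Lemma rnorm_sum_coord_inj (M : nat) (u : forall n, X n) :
  rnorm (\sum_(n < M) coord_inj n (u n)) `^ p = \sum_(n < M) rnorm (u n) `^ p.
Proof.
apply/EFin_inj; rewrite rnorm_powR /psum (@nneseries_split _ _ 0 M)// add0n.
rewrite eseries0 ?adde0 ?big_mkord ?sumEFin//.
  by congr EFin; apply: eq_bigr => n _; rewrite sum_coord_injE ltn_ord.
by move=> n Mn _; rewrite sum_coord_injE ltnNge Mn/= rnorm0 powR0// gt_eqF.
Qed.

Lemma sum_rnorm_coord (M : nat) (v : S) :
  \sum_(n < M) rnorm (v n) `^ p <= rnorm v `^ p.
Proof.
rewrite -lee_fin rnorm_powR -sumEFin.
rewrite -(big_mkord xpredT (fun n => (rnorm (v n) `^ p)%:E)).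
exact: nneseries_lim_ge.
Qed.

Lemma rnorm_coord (n : nat) (v : S) : rnorm (v n) <= rnorm v.
Proof.
apply: (powR_le_inv _ p); rewrite ?rnorm_ge0//.
apply: le_trans (sum_rnorm_coord n.+1 v).
by rewrite big_ord_recr /= lerDr sumr_ge0// => i _; exact: powR_ge0.
Qed.

(** Finitely supported vectors are dense: the [p]-th power of the norm of the remainder is a tail of
    a convergent series. *)
Lemma coord_truncation (v : S) (e : R) : 0 < e ->
  exists M, rnorm (v - \sum_(n < M) coord_inj n (v n)) <= e.
Proof.
move=> e0.
have tail M : (rnorm (v - \sum_(n < M) coord_inj n (v n)) `^ p)%:E =
    (\sum_(M <= n <oo) (rnorm (v n) `^ p)%:E)%E.
  rewrite rnorm_powR /psum (@nneseries_split _ _ 0 M)// add0n big_nat big1 ?add0e.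
    rewrite ereal_series [RHS]ereal_series; apply: eq_eseriesr => n Mn.
    by rewrite lpsum_subE sum_coord_injE ltnNge Mn subr0.
  move=> n /andP[_ nM].
  by rewrite lpsum_subE sum_coord_injE nM subrr rnorm0 powR0// gt_eqF.
have [L _ Ltail] : \forall N \near \oo,
    (\sum_(N <= n <oo) (rnorm (v n) `^ p)%:E < (e `^ p)%:E)%E.
  have := @nneseries_tail_cvg R (fun n => (rnorm (v n) `^ p)%:E) xpredT.
  rewrite -/(psum p v) -ge0_fin_numE ?psum_ge0// (psum_fin v) => /(_ erefl).
  move=> /(_ (fun n _ => term_ge0 v n)) tail0.
  apply: (tail0 [set y | (y < (e `^ p)%:E)%E]); apply: open_ereal_lt'.
  by rewrite lte_fin powR_gt0.
have vL := Ltail L (leqnn L).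
exists L; apply: (powR_le_inv _ p); rewrite ?rnorm_ge0 ?(ltW e0)//.
by rewrite -lee_fin tail ltW.
Qed.

End Coordinates.

(** * Support functionals of the l^p sum *)

Section Duality.
Context (R : realType) (k : scalars).
Local Notation K := (scalar_field R k).
Context (X : nat -> normedModType K) (p q : R) (p1 : 1 < p).
Hypothesis pq : p^-1 + q^-1 = 1.
Local Notation S := (lpsum X (ltW p1)).
Local Notation inj := (coord_inj R k X p (ltW p1)).

Let p0 : 0 < p. Proof. exact: lt_trans p1. Qed.
Let q0 : 0 < q. Proof. exact: conjugate_gt0 p1 pq. Qed.

(** Hoelder's inequality gives the bound on finitely supported vectors and density extends it. The
    crude constant [C] supplies continuity and does not enter the conclusion. *)
Lemma bounded_by_coordinates (h : {linear S -> K^o}) (C : R) (c : nat -> R)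
    (A : R) : 0 <= C -> (forall v, to_real `|h v| <= C * rnorm v) ->
  (forall n, 0 <= c n) -> 0 <= A ->
  (forall n u, to_real `|h (inj n u)| <= c n * rnorm u) ->
  (forall M, \sum_(n < M) c n `^ q <= A `^ q) ->
  forall v, to_real `|h v| <= A * rnorm v.
Proof.
move=> C0 hC c0 A0 hc cA v; apply/ler_addgt0Pr => e e0.
have C1 : 0 < C + 1 by rewrite ltr_wpDl.
have [M] := coord_truncation R k X p (ltW p1) v (e / (C + 1)) (divr_gt0 e0 C1).
set t := \sum_(n < M) _ => vt.
have hvt : to_real `|h (v - t)| <= e.
  apply: (le_trans (hC _)); apply: (le_trans (ler_wpM2l C0 vt)).
  by rewrite mulrCA ler_piMr ?(ltW e0)// ler_pdivrMr// mul1r lerDl.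
have ht : to_real `|h t| <= A * rnorm v.
  rewrite /t linear_sum /=.
  apply: (le_trans (ler_rnorm_sum R k K^o M (fun n => h (inj n (v n))))).
  apply: (@le_trans _ _ (\sum_(n < M) c n * rnorm (v n))).
    by apply: ler_sum => n _; exact: hc.
  apply: (hoelder_sum R p q p1 pq M c (fun n => rnorm (v n))) => //.
  - by move=> n; exact: rnorm_ge0.
  - exact: rnorm_ge0.
  - exact: sum_rnorm_coord.
have -> : h v = h t + h (v - t) by rewrite -linearD addrC subrK.
apply: (le_trans (ler_rnormD (h t : K^o) (h (v - t)))).
exact: lerD.
Qed.

Context (x : S).
Hypothesis x0 : x != 0.
Let N := rnorm x.

Let N0 : 0 < N. Proof. by rewrite rnorm_gt0. Qed.

Let c n : R := (rnorm (x n) / N) `^ (p - 1).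

Let c_ge0 n : 0 <= c n. Proof. exact: powR_ge0. Qed.

Let cE n : c n = rnorm (x n) `^ (p - 1) / N `^ (p - 1).
Proof. by rewrite /c powR_div ?rnorm_ge0// ltW. Qed.

Let c_eq0 n : x n = 0 -> c n = 0.
Proof. by move=> xn; rewrite /c xn rnorm0 mul0r powR0// gt_eqF// subr_gt0. Qed.

Let c_gt0 n : x n != 0 -> 0 < c n.
Proof. by move=> xn; rewrite powR_gt0// divr_gt0// rnorm_gt0. Qed.

Let c_powq n : c n `^ q = rnorm (x n) `^ p / N `^ p.
Proof.
by rewrite /c -powRrM (conjugate_mul R p q p1 pq) powR_div ?rnorm_ge0// ltW.
Qed.

Lemma sum_coord_weight M : \sum_(n < M) c n `^ q <= 1.
Proof.
under eq_bigr do rewrite c_powq.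
rewrite -mulr_suml ler_pdivrMr ?powR_gt0// mul1r.
exact: sum_rnorm_coord.
Qed.

(** * Restrictions of a support functional to the summands *)

Section SupportFunctional.
Context (f : {linear S -> K^o}).
Hypothesis Jf : J x f.

Let f_le v : to_real `|f v| <= rnorm v.
Proof. exact: (proj1 (proj1 (JP R k S x f x0) Jf) v). Qed.

Let fx : f x = `|x|.
Proof. by have [] := Jf. Qed.

(** Rests on [N + Re f(u) = Re f(x + u) <= ||x + u||], where [x] and [x + u] differ in one
    coordinate. *)
Lemma J_directional n (u : X n) :
  N `^ (p - 1) * to_real (f (inj n u)) <=
  rnorm (x n + u) `^ (p - 1) * (rnorm (x n + u) - rnorm (x n)).
Proof.
have y_le : N + to_real (f (inj n u)) <= rnorm (x + inj n u).
  apply: le_trans (f_le (x + inj n u)).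
  apply: le_trans (to_real_le_norm R k _).
  rewrite linearD.
  rewrite to_realD.
  rewrite fx.
  exact: lexx.
apply: (directional_bound R p q p1 pq N (rnorm (x + inj n u)) _ _ _ _ _ _ _ y_le).
- exact: rnorm_ge0.
- exact: rnorm_ge0.
- exact: rnorm_ge0.
- exact: rnorm_ge0.
have := rnorm_swap R k X p (ltW p1) n (x + inj n u) x.
rewrite lpsum_addE coord_injK; apply=> m mn.
by rewrite lpsum_addE coord_inj_neq// addr0.
Qed.

(** A rotation makes the value of [f] equal to its modulus; then [x] is perturbed along [u] with a
    positive step tending to 0. *)
Lemma J_coord_le n (u : X n) : to_real `|f (inj n u)| <= c n * rnorm u.
Proof.
have [a a1 afu] := ex_rotation R k (f (inj n u)).
have {afu} -> : `|f (inj n u)| = f (inj n (a *: u)) by rewrite !linearZ_LR.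
have {a1} -> : rnorm u = rnorm (a *: u).
  by rewrite rnormZ a1 -(of_real1 R) of_realK mul1r.
move: (a *: u) => {a}u.
have [->|u0] := eqVneq u 0.
  by rewrite !linear0 rnorm0 mulr0 -(@of_real0 R k) of_realK.
rewrite cE mulrAC ler_pdivlMr ?powR_gt0// [leLHS]mulrC.
apply: (right_directional_bound R p p1); rewrite ?rnorm_ge0 ?rnorm_gt0// => e e0.
have t0 : 0 <= e / rnorm u by rewrite divr_ge0 ?rnorm_ge0// ltW.
exists (rnorm (x n + of_real k (e / rnorm u) *: u)).
  rewrite rnorm_ge0 /= (le_trans (ler_rnormD _ _))// rnormZr//.
  by rewrite divfK// gt_eqF// rnorm_gt0.
have := J_directional n (of_real k (e / rnorm u) *: u).
by rewrite !linearZ_LR to_realZ.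
Qed.

(** Shrinking the coordinate [x n] gives a lower bound on the real part that matches
    [J_coord_le]. *)
Lemma J_coord_self n : f (inj n (x n)) = of_real k (c n * rnorm (x n)).
Proof.
have [xn|xn] := eqVneq (x n) 0.
  by rewrite xn !linear0 rnorm0 mulr0 of_real0.
apply: to_real_norm_eq; last exact: J_coord_le.
rewrite cE mulrAC ler_pdivrMr ?powR_gt0// [leRHS]mulrC.
apply: (left_directional_bound R p p1); first by rewrite rnorm_gt0.
move=> t /andP[t0 t1].
have := J_directional n (of_real k (- t) *: x n).
rewrite !linearZ_LR to_realZ.
have -> : x n + of_real k (- t) *: x n = of_real k (1 - t) *: x n.
  by rewrite of_realD of_real1 scalerDl scale1r.
by rewrite rnormZr// subr_ge0 ltW.
Qed.

Lemma J_coord0 n (u : X n) : x n = 0 -> f (inj n u) = 0.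
Proof.
move=> xn; apply: (@rnorm0_eq0 R k K^o); apply/le_anti; rewrite rnorm_ge0 andbT.
by have := J_coord_le n u; rewrite c_eq0// mul0r.
Qed.

(** [phi] is the restriction divided by [c n > 0]; [J_coord_le] and [J_coord_self] say that it
    supports [x n]. *)
Lemma J_coord n : x n != 0 -> exists phi, J (x n) phi /\
  forall u, f (inj n u) = of_real k (c n) * phi u.
Proof.
move=> xn; have cn := c_gt0 n xn.
have c'0 : 0 <= (c n)^-1 by rewrite invr_ge0 ltW.
have c'K : of_real k (c n)^-1 * of_real k (c n) = 1 :> K.
  by rewrite -of_realM mulVf ?of_real1// gt_eqF.
have [|phi phiE] := ex_linear _ (X n) K^o
  (fun u => of_real k (c n)^-1 * f (inj n u)).
  move=> a u v; rewrite !linearP /= mulrDr; congr (_ + _).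
  exact: mulrCA.
exists phi; split=> [|u]; last first.
  by rewrite phiE mulrA [_ * of_real _ _^-1]mulrC c'K mul1r.
apply/JP => //; split=> [u|].
  rewrite phiE normrM -[`|f _|]to_realK// -[`|of_real _ _|]to_realK//.
  rewrite to_real_norm_of_real// -of_realM of_realK ler_pdivrMl//.
  exact: J_coord_le.
by rewrite phiE J_coord_self of_realM mulrA c'K mul1r rnormE.
Qed.

End SupportFunctional.

(** * Prescribing finitely many restrictions *)

Let mul_of_real_norm (t : R) (z : K) : 0 <= t ->
  to_real `|of_real k t * z| = t * to_real `|z|.
Proof. exact: (rnormZr R k K^o t z). Qed.

(** Old and new restriction agree at [x n], which keeps the value at [x]. Each restriction still has
    norm at most [c m], and the partial sums of [c m ^ q] are at most 1, which keeps the norm. *)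
Lemma J_replace (f : {linear S -> K^o}) n (phi : {linear X n -> K^o}) :
  J x f -> x n != 0 -> J (x n) phi -> exists g, [/\ J x g,
    forall u, g (inj n u) = of_real k (c n) * phi u &
    forall m u, m != n -> g (inj m u) = f (inj m u)].
Proof.
move=> Jf xn Jphi.
have [f_le fx] := proj1 (JP R k S x f x0) Jf.
have [phi_le phix] := proj1 (JP R k (X n) (x n) phi xn) Jphi.
have [|g gE] := ex_linear _ S K^o
  (fun v => f v + (of_real k (c n) * phi (v n) - f (inj n (v n)))).
  move=> a v w.
  have fl : f (a *: v + w) = a * f v + f w by exact: linearP.
  have phil : phi ((a *: v + w) n) = a * phi (v n) + phi (w n) by exact: linearP.
  have injl : f (inj n ((a *: v + w) n)) = a * f (inj n (v n)) + f (inj n (w n)).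
    by rewrite lpsum_addE lpsum_scaleE !linearP.
  rewrite fl phil injl -[_ *: _]/(a * _).
  move: (of_real k (c n)) (f v) (f w) (phi (v n)) (phi (w n)) => c' y1 y2 y3 y4.
  move: (f (inj n (v n))) (f (inj n (w n))) => y5 y6.
  by rewrite !(mulrDr, mulrBr) [c' * (a * y3)]mulrCA mulrN; ring.
have gn u : g (inj n u) = of_real k (c n) * phi u.
  by rewrite gE coord_injK addrC subrK.
have gm m u : m != n -> g (inj m u) = f (inj m u).
  move=> mn; rewrite gE coord_inj_neq 1?eq_sym//.
  by rewrite !linear0 mulr0 !addr0.
exists g; split=> //; apply/(JP R k S x g x0); split; last first.
  rewrite gE fx phix (J_coord_self f Jf) -[`|x n|]rnormE -of_realM.
  by rewrite subrr addr0.
(* A crude bound that gives continuity of [g]; [bounded_by_coordinates] then sharpens the constant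
   to 1. *)
have g_le v : to_real `|g v| <= (2 + c n) * rnorm v.
  rewrite gE.
  apply: (le_trans (ler_rnormD (f v : K^o) _)).
  have -> : (2 + c n) * rnorm v = rnorm v + (c n * rnorm v + rnorm v).
    by move: (rnorm v) => r; ring.
  apply: lerD; first exact: f_le.
  apply: (le_trans (ler_rnormD (of_real k (c n) * phi (v n) : K^o) _)).
  apply: lerD.
    apply: (@le_trans _ _ (c n * to_real `|phi (v n)|)).
      by rewrite -mul_of_real_norm.
    apply: (ler_wpM2l (c_ge0 n)).
    exact: le_trans (phi_le (v n)) (rnorm_coord R k X p (ltW p1) n v).
  rewrite rnormN; apply: (le_trans (f_le (inj n (v n)))).
  by rewrite rnorm_coord_inj; exact: rnorm_coord.
have C0 : 0 <= 2 + c n by rewrite addr_ge0.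
have coord_le m u : to_real `|g (inj m u)| <= c m * rnorm u.
  have [mn|mn] := eqVneq m n; last by rewrite gm//; exact: J_coord_le.
  subst m; rewrite gn mul_of_real_norm// ler_wpM2l//; exact: phi_le.
move=> v; rewrite -[leRHS]mul1r.
apply: (bounded_by_coordinates g _ c 1 C0 g_le c_ge0 ler01 coord_le).
by move=> M; rewrite powR1; exact: sum_coord_weight.
Qed.

Lemma J_glue (phi : forall n, {linear X n -> K^o}) (M : nat) :
  (forall n, x n != 0 -> J (x n) (phi n)) ->
  exists2 f, J x f & forall n u, (n < M)%N -> x n != 0 ->
    f (inj n u) = of_real k (c n) * phi n u.
Proof.
move=> Jphi; elim: M => [|M [f Jf fE]].
  by have [f Jf] := J_nonempty R k S x x0; exists f.
have [xM|xM] := eqVneq (x M) 0.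
  exists f => // n u; rewrite ltnS leq_eqVlt => /predU1P[nM|]; last exact: fE.
  by subst n; rewrite xM eqxx.
have [g [Jg gM gn]] := J_replace f M (phi M) Jf xM (Jphi M xM).
exists g => // n u; rewrite ltnS leq_eqVlt => /predU1P[nM|nM xn].
  by subst n => _; exact: gM.
by rewrite gn ?fE// ltn_eqF.
Qed.

(** * The two bounds on the diameter and the resulting formula *)

Let a n := c n * fine (D (x n)).

(** The factor [c n = 0] cancels whatever [D] gives at the zero vector, in line with the convention
    on zero terms. *)
Let a_eq0 n : x n = 0 -> a n = 0.
Proof. by move=> xn; rewrite /a c_eq0// mul0r. Qed.

Let a_ge0 n : 0 <= a n.
Proof.
have [xn|xn] := eqVneq (x n) 0; first by rewrite a_eq0.
by rewrite mulr_ge0// fine_D_ge0.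
Qed.

(** On each summand with [x n] non-zero, [f - g] is [c n] times a difference of support functionals
    of [x n], hence of norm at most [a n]; on the others it vanishes. *)
Lemma J_dist_le (f g : {linear S -> K^o}) (A : R) : J x f -> J x g -> 0 <= A ->
  (forall M, \sum_(n < M) a n `^ q <= A `^ q) -> (dual_norm (f \- g)%R <= A%:E)%E.
Proof.
move=> Jf Jg A0 aA; apply: dual_norm_le => //.
apply: (bounded_by_coordinates (f \- g : {linear S -> K^o}) 2 a A) => //.
  move=> v; apply: (le_trans (J_dist R k S x x0 f g v Jf Jg)).
  by rewrite ler_wpM2r ?rnorm_ge0//; exact: fine_D_le2.
move=> n u /=; have [xn|xn] := eqVneq (x n) 0.
  by rewrite !J_coord0// subrr normr0 to_real0 mulr_ge0// rnorm_ge0.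
have [phi [Jphi ->]] := J_coord f Jf n xn.
have [psi [Jpsi ->]] := J_coord g Jg n xn.
rewrite -mulrBr mul_of_real_norm// /a -mulrA ler_wpM2l//.
exact: J_dist.
Qed.

(** Nearly optimal pairs in the first [M] summands are glued into [f] and [g], whose difference is
    tested at one vector [v]. *)
Lemma D_ge_partial (lambda : R) (M : nat) : 0 < lambda < 1 ->
  lambda * (\sum_(n < M) a n `^ q) `^ q^-1 <= fine (D x).
Proof.
move=> l01; have l0 : 0 <= lambda by case/andP: l01 => /ltW.
have near_D n : exists t : {linear X n -> K^o} * {linear X n -> K^o} * X n,
    x n != 0 -> [/\ J (x n) t.1.1, J (x n) t.1.2, rnorm t.2 <= 1 &
      lambda * fine (D (x n)) <= to_real (t.1.1 t.2 - t.1.2 t.2)].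
  have [xn|xn] := eqVneq (x n) 0.
    by exists ((\0 : {linear X n -> K^o}), (\0 : {linear X n -> K^o}), 0).
  have [phi [psi [v H]]] := D_almost_attained R k (X n) (x n) xn lambda l01.
  by exists (phi, psi, v).
pose t n := projT1 (cid (near_D n)).
have tP n : x n != 0 ->
    [/\ J (x n) (t n).1.1, J (x n) (t n).1.2, rnorm (t n).2 <= 1 & lambda * fine (D (x n)) <= to_real ((t n).1.1 (t n).2 - (t n).1.2 (t n).2)].
  by rewrite /t; case: cid.
have [|f Jf fE] := J_glue (fun n => (t n).1.1) M; first by move=> n /tP[].
have [|g Jg gE] := J_glue (fun n => (t n).1.2) M; first by move=> n /tP[].
pose b n := lambda * a n.
have b0 n : 0 <= b n by rewrite mulr_ge0.
(* These weights are extremal in Hoelder's inequality: [(q - 1) * p = q] gives [||v|| ^ p <= B],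
   while [f v - g v] has real part at least the sum of [b n ^ (q - 1) * b n], again [B]. *)
pose u n := of_real k (b n `^ (q - 1)) *: (t n).2.
pose v := \sum_(n < M) inj n (u n).
pose B := \sum_(n < M) b n `^ q.
have B0 : 0 <= B by apply: sumr_ge0 => n _; exact: powR_ge0.
have q1 : 1 < q by exact: conjugate_gt1 p1 pq.
have b_eq0 n : x n = 0 -> b n = 0 by move=> xn; rewrite /b a_eq0 ?mulr0.
have v_le : rnorm v <= B `^ p^-1.
  apply: (powR_le_inv R p _ _ p0 (rnorm_ge0 v) (powR_ge0 _ _)).
  rewrite -powRrM mulVf ?gt_eqF// powRr1//.
  rewrite /v (rnorm_sum_coord_inj R k X p (ltW p1) M u) /u.
  apply: ler_sum => n _; have [xn|xn] := eqVneq (x n) 0.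
    rewrite (b_eq0 _ xn) !powR0 ?gt_eqF ?subr_gt0// of_real0 scale0r rnorm0.
    by rewrite powR0 ?gt_eqF.
  have [_ _ t1 _] := tP n xn.
  rewrite rnormZr ?powR_ge0// powRM ?powR_ge0 ?rnorm_ge0// -powRrM.
  rewrite (conjugate_mulC R p q p1 pq) ler_piMr ?powR_ge0//.
  have -> : 1 = 1 `^ p :> R by rewrite powR1.
  by apply: ge0_ler_powR; rewrite ?nnegrE ?rnorm_ge0 ?(ltW p0).
have B_le : B <= to_real (f v - g v).
  have -> : f v - g v = \sum_(n < M)
      (f (inj n (u n)) - g (inj n (u n))).
    by rewrite /v [f _]linear_sum [g _]linear_sum sumrB.
  rewrite to_real_sum /u; apply: ler_sum => n _.
  have [xn|xn] := eqVneq (x n) 0.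
    rewrite (b_eq0 _ xn) !powR0 ?gt_eqF ?subr_gt0// of_real0 scale0r.
    by rewrite !linear0 !addr0 to_real0.
  have [_ _ _ tn] := tP n xn.
  have -> : f (inj n (of_real k (b n `^ (q - 1)) *: (t n).2)) -
      g (inj n (of_real k (b n `^ (q - 1)) *: (t n).2)) =
      of_real k (c n) * (of_real k (b n `^ (q - 1)) *
        ((t n).1.1 (t n).2 - (t n).1.2 (t n).2)).
    have phiZ (phi : {linear X n -> K^o}) s w : phi (s *: w) = s * phi w.
      exact: linearZ_LR.
    by rewrite (fE n _ (ltn_ord n) xn) (gE n _ (ltn_ord n) xn) !phiZ !mulrBr.
  rewrite !to_realZ.
  rewrite -(mulr_powRB1 (b0 n) q0) mulrCA [leLHS]mulrC ler_wpM2l ?powR_ge0//.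
  by rewrite /b /a mulrCA ler_wpM2l.
have B_root : B `^ q^-1 <= fine (D x).
  apply: (conjugate_root_le R p q p1 pq) => //; first exact: fine_D_ge0.
  apply: (le_trans B_le); apply: (le_trans (to_real_le_norm R k _)).
  apply: (le_trans (J_dist R k S x x0 f g v Jf Jg)).
  by apply: ler_wpM2l => //; exact: fine_D_ge0.
apply: le_trans B_root; rewrite le_eqVlt; apply/orP; left; apply/eqP.
have -> : B = lambda `^ q * \sum_(n < M) a n `^ q.
  by rewrite mulr_sumr; apply: eq_bigr => n _; rewrite powRM.
rewrite powRM ?powR_ge0 ?sumr_ge0// => [|n _]; last exact: powR_ge0.
by rewrite -powRrM mulfV ?gt_eqF// powRr1.
Qed.

Lemma sum_le_D_powq (M : nat) : \sum_(n < M) a n `^ q <= fine (D x) `^ q.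
Proof.
set s := \sum_(n < M) _.
have s0 : 0 <= s by apply: sumr_ge0 => n _; exact: powR_ge0.
have d0 : 0 <= fine (D x) by exact: fine_D_ge0.
have -> : s = (s `^ q^-1) `^ q by rewrite -powRrM mulVf ?gt_eqF// powRr1.
apply: ge0_ler_powR; rewrite ?nnegrE ?powR_ge0 ?(ltW q0)//.
(* The exponent 1 brings the goal into the form of [powR_left_limit_le], which lets [lambda = 1 - t]
   tend to 1. *)
rewrite -[leLHS]powRr1 ?powR_ge0//.
apply: powR_left_limit_le; rewrite ?powR_ge0// => t /andP[t0 t1].
rewrite powRr1 ?mulr_ge0 ?powR_ge0 ?subr_ge0 ?(ltW t1)//.
by apply: D_ge_partial; rewrite subr_gt0 t1 ltrBlDl ltrDr.
Qed.

Lemma D_lpsumE : D x = ((\sum_(0 <= n <oo) (a n `^ q)%:E) `^ q^-1)%E.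
Proof.
have term0 n : (0 <= (a n `^ q)%:E)%E by rewrite lee_fin powR_ge0.
have partial M : (\sum_(0 <= n < M) (a n `^ q)%:E = (\sum_(n < M) a n `^ q)%:E)%E.
  by rewrite big_mkord sumEFin.
have le_Dq : (\sum_(0 <= n <oo) (a n `^ q)%:E <= (fine (D x) `^ q)%:E)%E.
  apply: lime_le; first exact: is_cvg_nneseries.
  by near=> M; rewrite partial lee_fin; exact: sum_le_D_powq.
have ge_partial M : ((\sum_(n < M) a n `^ q)%:E <=
    \sum_(0 <= n <oo) (a n `^ q)%:E)%E.
  by rewrite -partial; exact: nneseries_lim_ge.
have s0 : (0 <= \sum_(0 <= n <oo) (a n `^ q)%:E)%E by exact: nneseries_ge0.
(* [le_Dq] excludes [+oo] and [s0] excludes [-oo], so the series is a real [s]. *)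
move: (\sum_(0 <= n <oo) (a n `^ q)%:E)%E le_Dq ge_partial s0 => [s| |]//.
rewrite !lee_fin => s_le ge_partial s0.
have d0 : 0 <= fine (D x) by exact: fine_D_ge0.
rewrite poweR_EFin; apply/le_anti/andP; split.
  apply: ge_ereal_sup => _ [f Jf [g Jg <-]].
  apply: J_dist_le; rewrite ?powR_ge0// => M.
  by rewrite -powRrM mulVf ?gt_eqF// powRr1// -lee_fin.
rewrite -[leRHS]fineK ?D_fin_num// lee_fin.
apply: (powR_le_inv _ q); rewrite ?powR_ge0//.
by rewrite -powRrM mulVf ?gt_eqF// powRr1.
Unshelve. all: by end_near. Qed.

Lemma lpsum_termE n :
  ((if x n != 0%R then (rnorm (x n) `^ p / rnorm x `^ p)%R%:E * D (x n) `^ q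
    else 0) = (a n `^ q)%:E)%E.
Proof.
have [xn|xn] /= := eqVneq (x n) 0; first by rewrite a_eq0 ?powR0 ?gt_eqF.
rewrite -(fineK (D_fin_num R k (X n) (x n) xn)) poweR_EFin -EFinM.
by rewrite /a powRM ?fine_D_ge0// c_powq.
Qed.

End Duality.

Theorem theorem10 (R : realType) (k : scalars)
    (X : nat -> normedModType (scalar_field R k))
    (X_nontrivial : forall n, exists v : X n, v != 0)
    (p q : R) (p1 : 1 < p) (pq : p^-1 + q^-1 = 1)
    (x : lpsum X (ltW p1)) (x_neq0 : x != 0) :
  D x = ((\sum_(0 <= n <oo | x n != 0%R)
            ((rnorm (x n) `^ p / rnorm x `^ p)%R%:E * D (x n) `^ q)) `^ q^-1)%E.
Proof.
rewrite (D_lpsumE R k X p q p1 pq x x_neq0) [in RHS]eseries_mkcond.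
congr (_ `^ _)%E; apply: eq_eseriesr => n _.
exact/esym/lpsum_termE.
Qed.
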